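(* Let $\sigma(z)=\eta(z+a_1)$ and $\theta(z)=z(z+b_1)(z+b_2)$, with weight $w(k)=\frac{(a_1)_k}{(b_1+1)_k(b_2+1)_k}\frac{\eta^k}{k!}$, $k\in\mathbb N_0$, and let $p^1_n,\beta_n,\gamma_n,H_n,\pi^{[2]}_n,\Psi$ be the associated objects described in the context. Then, for every $n\in\mathbb N_0$ (with $\eta+\gamma_{n+1}\neq 0$), the subleading coefficient of $P_n$ is $$\begin{aligned}p^1_n=\frac{n(n+1)}{2}-n\beta_n-\frac{1}{\eta+\gamma_{n+1}}\Big(&\gamma_{n+1}\big(\gamma_n+\gamma_{n+1}+\gamma_{n+2}+(\beta_{n+1}+b_1)(\beta_{n+1}+b_2)+\beta_n(\beta_{n+1}+\beta_n+b_1+b_2)\\&-n(2\beta_n+\beta_{n+1}+b_1+b_2-n)-\eta\big)-\eta(n+1)(\beta_n+a_1)\Big),\end{aligned}$$ and $$\begin{aligned}\pi^{[2]}_{n-1}=\frac{1}{\eta+\gamma_{n+1}}\Big(&\gamma_{n+1}\big(\gamma_n+\gamma_{n+1}+\gamma_{n+2}+(\beta_{n+1}+b_1)(\beta_{n+1}+b_2)+\beta_n(\beta_{n+1}+\beta_n+b_1+b_2)\\&-n(2\beta_n+\beta_{n+1}+b_1+b_2-n)-\eta\big)-\eta(n+1)(\beta_n+a_1)\Big).\end{aligned}$$ Moreover, the Laguerre--Freud structure matrix $\Psi=(\Psi_{i,j})_{i,j\in\mathbb N_0}$ is pentadiagonal: its only possibly nonzero entries are, for $n\in\mathbb N_0$,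 $$\Psi_{n+1,n}=\eta H_{n+1},\quad \Psi_{n,n}=\psi^{(0)}_n,\quad \Psi_{n,n+1}=\psi^{(1)}_n,\quad \Psi_{n,n+2}=\psi^{(2)}_n,\quad \Psi_{n,n+3}=H_{n+3},$$ where $$\begin{aligned}\psi^{(0)}_n&=\eta H_n(n+\beta_n+a_1),\\ \psi^{(1)}_n&=\eta\Big(H_{n+1}+H_n\big(\pi^{[2]}_{n-1}+(n+1)(\beta_n+a_1)\big)\Big),\\ \psi^{(2)}_n&=H_{n+2}(\beta_n+\beta_{n+1}+\beta_{n+2}+b_1+b_2-n).\end{aligned}$$
   Context: $\mathbb N_0=\{0,1,2,\dots\}$ and $(a)_k=a(a+1)\cdots(a+k-1)$, $(a)_0=1$. The parameters $a_1,b_1,b_2$ and $\eta\neq0$ are such that the weight is well defined ($b_1,b_2$ are not negative integers). The weight satisfies the Pearson equation $\theta(k+1)w(k+1)=\sigma(k)w(k)$, $k\in\mathbb N_0$. The moments are $\rho_n=\sum_{k=0}^\infty k^n w(k)$ (convergent for all $\eta$; $\rho_0={}_1F_2(a_1;b_1+1,b_2+1;\eta)$). The moment matrix is $G=(\rho_{n+m})_{n,m\in\mathbb N_0}$; standing assumption: all Hankel determinants $\det(\rho_{i+j})_{0\le i,j\le k-1}$ are nonzero. Then there are unique monic polynomials $P_n(z)=z^n+p^1_nz^{n-1}+\cdots$, $n\in\mathbb N_0$, with $\sum_{k\ge0}P_n(k)P_m(k)w(k)=\delta_{n,m}H_n$, $H_n\ne0$. They satisfy $zP_n=P_{n+1}+\beta_nP_n+\gamma_nP_{n-1}$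 with $\beta_n=p^1_n-p^1_{n+1}$ and $\gamma_{n+1}=H_{n+1}/H_n$. Conventions: $p^1_0=0$, $\gamma_0=0$, $P_{-1}=0$. Write $P=(P_0,P_1,\dots)^\top$, $H=\operatorname{diag}(H_0,H_1,\dots)$, and let $J$ be the tridiagonal Jacobi matrix with $J_{n,n+1}=1$, $J_{n,n}=\beta_n$, $J_{n+1,n}=\gamma_{n+1}$, so $JP(z)=zP(z)$. The dressed Pascal matrix $\Pi$ is the lower unitriangular semi-infinite matrix with $P(z+1)=\Pi P(z)$; equivalently $P(z-1)=\Pi^{-1}P(z)$. Its second subdiagonal is denoted $\pi^{[2]}_n:=\Pi_{n+2,n}$, $n\in\mathbb N_0$, with the convention $\pi^{[2]}_{-1}=0$. The Laguerre--Freud structure matrix is $\Psi:=\Pi^{-1}H\theta(J^\top)=\sigma(J)H\Pi^\top$ (the equality of the two expressions being a known consequence of the Pearson equation). *)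

(* Defs.v *)
From HB Require Import structures.
From mathcomp Require Import all_boot all_order all_algebra.
From mathcomp Require Import complex ring.
From mathcomp Require Import all_classical all_reals.
From mathcomp Require Import topology normedtype sequences.

Set Implicit Arguments.
Unset Strict Implicit.
Unset Printing Implicit Defensive.

Import Order.TTheory GRing.Theory Num.Theory.
Import numFieldNormedType.Exports.

Local Open Scope classical_set_scope.
Local Open Scope ring_scope.

Section SemiInfiniteMatrices.
Variable K : fieldType.

Definition smx := nat -> nat -> K.

Implicit Types A B : smx.

Definition smx_tr A : smx := fun i j => A j i.

Definition smx_diag (d : nat -> K) : smx := fun i j => if i == j then d i else 0.

Definition smx1 : smx := smx_diag (fun=> 1).

(* Finitely supported sum; it is the usual product whenever each row of A (or
   each column of B) has finitely many nonzero entries. *)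
Definition smx_mul A B : smx :=
  fun i j => \sum_(k \in [set: nat]) (A i k * B k j).

Definition smx_exp A n : smx := iter n (smx_mul A) smx1.

Definition smx_horner (p : {poly K}) A : smx :=
  fun i j => \sum_(k < size p) p`_k * smx_exp A k i j.

Definition lower_unitriangular A : Prop :=
  (forall i j, (i < j)%N -> A i j = 0) /\ (forall i, A i i = 1).

Definition smx_inverse A B : Prop :=
  smx_mul A B =2 smx1 /\ smx_mul B A =2 smx1.

End SemiInfiniteMatrices.

Section Weight.
Variable K : numFieldType.
Variables a1 b1 b2 eta : K.

Definition pochhammer (a : K) (k : nat) : K := \prod_(i < k) (a + i%:R).

Definition sigma : {poly K} := eta *: ('X + a1%:P).

Definition theta : {poly K} := 'X * ('X + b1%:P) * ('X + b2%:P).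

Definition weight (k : nat) : K :=
  pochhammer a1 k / (pochhammer (b1 + 1) k * pochhammer (b2 + 1) k)
  * (eta ^+ k / (k`!)%:R).

Definition not_negative_integer (b : K) : Prop := forall k : nat, b != - k.+1%:R.

Lemma pearson (hb1 : not_negative_integer b1) (hb2 : not_negative_integer b2) k :
  theta.[k.+1%:R] * weight k.+1 = sigma.[k%:R] * weight k.
Proof.
have nz b : not_negative_integer b -> forall i : nat, b + 1 + i%:R != 0.
  by move=> hb i; rewrite -addrA nat1r addr_eq0.
have pnz b : not_negative_integer b -> pochhammer (b + 1) k != 0.
  by move=> hb; apply/prodf_neq0 => i _; exact: nz.
have h1 := nz _ hb1 k; have h2 := nz _ hb2 k.
have p1 := pnz _ hb1; have p2 := pnz _ hb2.
have f0 : (k`!)%:R != 0 :> K by rewrite pnatr_eq0 -lt0n fact_gt0.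
have k0 : (k.+1)%:R != 0 :> K by rewrite pnatr_eq0.
have pS a : pochhammer a k.+1 = pochhammer a k * (a + k%:R).
  by rewrite /pochhammer big_ord_recr.
have -> : theta.[k.+1%:R] = k.+1%:R * (k.+1%:R + b1) * (k.+1%:R + b2).
  by rewrite !hornerE.
have -> : sigma.[k%:R] = eta * (k%:R + a1) by rewrite !hornerE.
rewrite /weight !pS factS natrM exprS; rewrite -nat1r in k0 *.
by field; rewrite f0 k0 p1 p2 h1 h2.
Qed.

End Weight.

Section OrthogonalPolynomials.
Variable K : numFieldType.
Variable w : nat -> K.

Definition moment (n : nat) : K :=
  limn (series (fun k : nat => k%:R ^+ n * w k)).

Definition hankel (k : nat) : 'M[K]_k := \matrix_(i, j) moment (i + j).

Variables (P : nat -> {poly K}) (H : nat -> K).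

Definition monic_orthogonal : Prop :=
  [/\ forall n, P n \is monic,
      forall n, size (P n) = n.+1,
      forall n, H n != 0
    & forall n m,
        series (fun k : nat => (P n).[k%:R] * (P m).[k%:R] * w k) @ \oo
          --> (if n == m then H n else 0)].

Definition p1 (n : nat) : K := if n is m.+1 then (P n)`_m else 0.

Definition beta (n : nat) : K := p1 n - p1 n.+1.

Definition gamma (n : nat) : K := if n is m.+1 then H m.+1 / H m else 0.

Definition jacobi : smx K := fun i j =>
  if j == i.+1 then 1
  else if j == i then beta i
  else if i == j.+1 then gamma i
  else 0.

(* The sum expressing P(z + 1) = Pi P(z) stops at n because Pi is lower
   triangular. *)
Definition dressed_pascal (Pi : smx K) : Prop :=
  lower_unitriangular Pi /\
  forall n, P n \Po ('X + 1) = \sum_(m < n.+1) Pi n m *: P m.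

(* Indexed by int to accommodate the convention pi2 (-1) = 0. *)
Definition pi2 (Pi : smx K) (n : int) : K :=
  if n is Posz m then Pi m.+2 m else 0.

(* PiV stands for the inverse of Pi. *)
Definition laguerre_freud (PiV : smx K) (th : {poly K}) : smx K :=
  smx_mul (smx_mul PiV (smx_diag H)) (smx_horner th (smx_tr jacobi)).

End OrthogonalPolynomials.

(* Main.v *)
Require Import Defs.
From HB Require Import structures.
From mathcomp Require Import all_boot all_order all_algebra.
From mathcomp Require Import complex ring.
From mathcomp Require Import all_classical all_reals.
From mathcomp Require Import topology normedtype sequences.

Import Order.TTheory GRing.Theory Num.Theory.
Import numFieldNormedType.Exports.

Local Open Scope classical_set_scope.
Local Open Scope ring_scope.

(** The orthogonality relations make every series [sum_k q(k) w(k)] converge, so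
    they define a linear functional [L] on polynomials, and the Pearson equation
    becomes [L (theta(z) q(z-1)) = L (sigma(z) q(z))]. Expanding the matrix
    products gives
    [Psi_(i,j) = L (theta(z) P_j(z) P_i(z-1)) = L (sigma(z) P_i(z) P_j(z+1))].
    The degree of [theta] bounds the upper bandwidth in the first expression and
    that of [sigma] the lower bandwidth in the second; each entry on the band
    depends on at most three leading coefficients of a polynomial. The entry
    [Psi_(n,n+1)] is computed in both ways: equating the results is a linear
    equation for [n (n+1) / 2 - n beta_n - p^1_n], which is [pi^[2]_(n-1)] by
    comparison of coefficients in [P_(n+1)(z+1)]. *)

(** * Leading coefficients under a shift of the variable *)

Section Shift.
Variable K : fieldType.
Implicit Types p q : {poly K}.

Lemma size_shift q (c : K) : size (q \Po ('X + c%:P)) = size q.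
Proof. by rewrite size_comp_poly2 // size_XaddC. Qed.

Lemma shiftK q (c : K) : (q \Po ('X + c%:P)) \Po ('X - c%:P) = q.
Proof.
by rewrite -comp_polyA comp_polyD comp_polyX comp_polyC subrK comp_polyXr.
Qed.

(* Multiplying by ['X^k] makes ['X^k * q]`_n the coefficient of degree [n - k]
   of [q], with value [0] when [n < k]. *)
Lemma coefXn_shift (c : K) n q : (size q <= n.+1)%N ->
  [/\ (q \Po ('X + c%:P))`_n = q`_n,
      ('X * (q \Po ('X + c%:P)))`_n = ('X * q)`_n + n%:R * c * q`_n
    & 2 * ('X^2 * (q \Po ('X + c%:P)))`_n =
      2 * (('X^2 * q)`_n + (n%:R - 1) * c * ('X * q)`_n)
      + n%:R * (n%:R - 1) * c ^+ 2 * q`_n].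
Proof.
elim: n q => [|n IHn] q sq.
  rewrite (size1_polyC sq) comp_polyC !coefXM !coefXnM /=.
  by split=> //; ring.
(* The induction is on [n]; here [poly_ind] only supplies the decomposition [q * 'X + a]. *)
elim/poly_ind: q sq => [|q a _] sq.
  by rewrite comp_poly0 !mulr0 !coef0; split=> //; ring.
have {}sq : (size q <= n.+1)%N.
  move: sq; rewrite size_MXaddC; case: ifP => // /andP[/eqP->].
  by rewrite size_poly0.
have [e0 e1 e2] := IHn q sq.
have z : (q \Po ('X + c%:P))`_n.+1 = 0 by rewrite nth_default ?size_shift.
rewrite comp_polyD comp_polyM comp_polyX comp_polyC.
move: e0 e1 e2 z; set t := q \Po _ => e0 e1 e2 z.
have tE : t * ('X + c%:P) + a%:P = 'X * t + c *: t + a%:P.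
  by rewrite mulrDr -!mul_polyC [t * 'X]mulrC [t * c%:P]mulrC.
rewrite tE [q * 'X]mulrC.
have XS r k : ('X * r)`_k.+1 = r`_k by rewrite coefXM.
have CS k : (a%:P)`_k.+1 = 0 by rewrite coefC.
(* The constant [a] contributes in degree [n] only when [n = 0], where the factor [n%:R] kills
   it. *)
have nC : n%:R * (a%:P)`_n = 0 by case: (n) => [|k]; rewrite ?mul0r ?CS ?mulr0.
rewrite !expr2 -!mulrA in e2 *; rewrite -nat1r; split.
- by rewrite !coefD coefZ !XS z e0 mulr0 addr0.
- by rewrite !XS !coefD coefZ !XS CS e0 e1; ring.
- rewrite !XS !mulrDr -scalerAr !coefD coefZ !XS CS e1.
  rewrite !mulrDr e2; ring: nC.
Qed.
End Shift.

(** * Expansion along a monic sequence of polynomials *)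

Section MonicBasis.
Variables (K : fieldType) (P : nat -> {poly K}).
Hypothesis P_monic : forall n, P n \is monic.
Hypothesis size_P : forall n, size (P n) = n.+1.

Lemma coef_P_diag n : (P n)`_n = 1.
Proof. by move/monicP: (P_monic n); rewrite /lead_coef size_P. Qed.

Lemma coef_P_gt n k : (n < k)%N -> (P n)`_k = 0.
Proof. by move=> nk; rewrite nth_default ?size_P. Qed.

Lemma P0E : P 0%N = 1.
Proof.
have /size1_polyC -> : (size (P 0%N) <= 1)%N by rewrite size_P.
by rewrite coef_P_diag.
Qed.

Lemma size_sub_lead {n} {q : {poly K}} :
  (size q <= n.+1)%N -> (size (q - q`_n *: P n)%R <= n)%N.
Proof.
move=> sq; apply/leq_sizeP => j; rewrite leq_eqVlt => /predU1P[<-|nj].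
  by rewrite coefB coefZ coef_P_diag mulr1 subrr.
by rewrite coefB coefZ coef_P_gt // mulr0 subr0 nth_default // (leq_trans sq).
Qed.

(** Subtracting the multiple of [P n] with the same top coefficient lowers the size, so every
    polynomial is reached from [0]. *)
Lemma monic_basis_ind (Q : {poly K} -> Prop) :
  Q 0 -> (forall c n q, Q q -> Q (c *: P n + q)) -> forall q, Q q.
Proof.
move=> Q0 QS q; have [n] := ubnP (size q).
elim: n q => // n IHn q sq; case: n IHn sq => [|n] IHn sq.
  by move: sq; rewrite ltnS size_poly_leq0 => /eqP->.
rewrite -(subrKC (q`_n *: P n) q); apply: QS; apply: IHn.
exact: size_sub_lead.
Qed.
End MonicBasis.

(** * The functional of the weight and its Pearson relation *)

(** Since [P 0 = 1], orthogonality of [P n] and [P 0] already gives convergence for each [P n];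
    linear combinations then cover all polynomials, and uniqueness of limits makes [L] linear. *)
Lemma weighted_sum_functional (K : numFieldType) (w : nat -> K)
    (P : nat -> {poly K}) (H : nat -> K) :
  monic_orthogonal w P H -> exists L : {scalar {poly K}},
  forall q, series (fun k : nat => q.[k%:R] * w k) @ \oo --> (L q : K).
Proof.
move=> [Pm sP _ PP].
pose s q := series (fun k : nat => q.[k%:R] * w k).
have sE c q r : s (c *: q + r) = (fun N => c * s q N + s r N).
  apply/funext => N; rewrite /s /series /= mulr_sumr -big_split /=.
  by apply: eq_bigr => k _; rewrite hornerD hornerZ mulrDl mulrA.
have scvg c q r a b : s q @ \oo --> a -> s r @ \oo --> b ->
    s (c *: q + r) @ \oo --> c * a + b.
  by move=> qa rb; rewrite sE; apply: cvgD => //; apply: cvgMr.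
have cv q : exists l : K, s q @ \oo --> l.
  elim/(monic_basis_ind _ _ Pm sP): q => [|c n q [l ql]].
    exists 0; rewrite (_ : s 0 = cst 0); first exact: cvg_cst.
    by apply/funext => N; rewrite /s /series /= big1 // => k _; rewrite horner0 mul0r.
  exists (c * (if n == 0%N then H n else 0) + l); apply: scvg => //.
  have := PP n 0%N; rewrite (P0E _ _ Pm sP).
  by under eq_fun do rewrite hornerC mulr1.
pose L q := sval (cid (cv q)).
have LP q : s q @ \oo --> L q by rewrite /L; case: cid.
have Llin : scalar L.
  move=> c q r; have := LP (c *: q + r); move/(cvg_unique _); apply => //.
  exact: scvg.
pose Lm := GRing.isLinear.Build _ _ _ _ L Llin.
pose LL : {scalar {poly K}} := HB.pack L Lm.
by exists LL.
Qed.

(** As [theta] vanishes at [0], the term [k = 0] drops out on the left, and the Pearson equation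
    matches the remaining terms after an index shift. *)
Lemma pearson_functional (K : numFieldType) (a1 b1 b2 eta : K)
    (L : {scalar {poly K}}) :
  not_negative_integer b1 -> not_negative_integer b2 ->
  (forall q, series (fun k : nat => q.[k%:R] * weight a1 b1 b2 eta k) @ \oo
     --> (L q : K)) ->
  forall q, L (theta b1 b2 * (q \Po ('X - 1%:P))) = L (sigma a1 eta * q).
Proof.
move=> b1_ok b2_ok LE q.
set w := weight a1 b1 b2 eta in LE *.
set r := theta b1 b2 * _; set t := sigma a1 eta * q.
have sE N : series (fun k : nat => r.[k%:R] * w k) N.+1
    = series (fun k : nat => t.[k%:R] * w k) N.
  rewrite /series /= big_nat_recl // {1}/r /theta !hornerM hornerX !mul0r add0r.
  apply: eq_bigr => k _; rewrite /r /t hornerM [in RHS]hornerM.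
  rewrite [LHS]mulrAC pearson // [LHS]mulrAC.
  by rewrite horner_comp !hornerE -natr1 addrK.
have rt : series (fun k : nat => r.[k%:R] * w k) @ \oo --> (L t : K).
  by rewrite -cvg_shiftS; under [X in X @ _]eq_fun do rewrite sE; exact: LE.
by have := LE r; move/(cvg_unique _); apply.
Qed.

(** A finitely supported sum defaults to [0] on infinite support, so each product has to be
    truncated by triangularity or bandedness before it can be computed. *)
Lemma smx_mulE {K : fieldType} {N : nat} {A B : smx K} {i j : nat} :
  (forall k, (N <= k)%N -> A i k * B k j = 0) ->
  smx_mul A B i j = \sum_(k < N) A i k * B k j.
Proof.
move=> AB0; rewrite /smx_mul (fsbig_ord _ _ (fun k => A i k * B k j)).
apply/esym/fsbig_widen => // k [_ /negP].
by rewrite -leqNgt => /AB0.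
Qed.

(** * Orthogonality, subleading coefficients and the three-term recurrence *)

Section OrthogonalFunctional.
Variables (K : numFieldType) (P : nat -> {poly K}) (H : nat -> K).
Variable L : {scalar {poly K}}.
Hypothesis P_monic : forall n, P n \is monic.
Hypothesis size_P : forall n, size (P n) = n.+1.
Hypothesis H_neq0 : forall n, H n != 0.
Hypothesis LPP : forall n m, L (P n * P m) = if n == m then H n else 0.
Implicit Types q f : {poly K}.

Let p := p1 P.
Let b := beta P.
Let g := gamma H.

(* Second subleading coefficient, with value [0] for [n < 2]. *)
Let p2 n := ('X^2 * P n)`_n.

Let coef_P_diag := @coef_P_diag K P P_monic size_P.
Let coef_P_gt := @coef_P_gt K P size_P.
Let size_sub_lead := @size_sub_lead K P P_monic size_P.

Lemma functionalZ c q : L (c *: q) = c * L q.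
Proof. exact: linearZ. Qed.

Lemma orthogonal_small n q : (size q <= n)%N -> L (P n * q) = 0.
Proof.
(* The size bound is generalized to [m <= n], so that [P n] stays fixed during the induction. *)
have: (n <= n)%N by []; move: {1 3}n => m; elim: m q => [|m IHm] q mn sq.
  by move: sq; rewrite size_poly_leq0 => /eqP->; rewrite mulr0 linear0.
rewrite -(subrKC (q`_m *: P m) q) mulrDr linearD /= -scalerAr linearZ /= LPP.
by rewrite gtn_eqF // mulr0 add0r IHm // ?size_sub_lead // ltnW.
Qed.

Lemma orthogonal_lead {n q} : (size q <= n.+1)%N -> L (P n * q) = H n * q`_n.
Proof.
move=> sq; rewrite -{1}(subrKC (q`_n *: P n) q) mulrDr linearD /= -scalerAr.
rewrite linearZ /= LPP eqxx orthogonal_small ?size_sub_lead // addr0.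
by rewrite mulrC.
Qed.

Lemma p1E n : p n = ('X * P n)`_n.
Proof. by rewrite /p coefXM; case: n. Qed.

Lemma p1S n : (P n.+1)`_n = p n.+1.
Proof. by []. Qed.

Lemma p2SS n : (P n.+2)`_n = p2 n.+2.
Proof. by rewrite /p2 coefXnM /= subn2. Qed.

(** Removing the components of [f] along [P n.+2] and [P n.+1] does not change the pairing with
    [P n]; what remains has size at most [n.+1], and only its coefficient of degree [n] counts. *)
Lemma orthogonal_top3 {n f} : (size f <= n.+3)%N ->
  L (P n * f) = H n * (f`_n - f`_n.+2 * p2 n.+2
                      - (f`_n.+1 - f`_n.+2 * p n.+2) * p n.+1).
Proof.
move=> sf; have := size_sub_lead _ _ sf; set f' := f - _ => sf'.
have := size_sub_lead _ _ sf'; set f'' := f' - _ => sf''.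
have fE : f = f`_n.+2 *: P n.+2 + (f'`_n.+1 *: P n.+1 + f'').
  by rewrite /f'' /f' !subrKC.
have f''n : f''`_n = f`_n - f`_n.+2 * p2 n.+2 - f'`_n.+1 * p n.+1.
  by rewrite coefB coefZ p1S coefB coefZ p2SS.
have f'n : f'`_n.+1 = f`_n.+1 - f`_n.+2 * p n.+2 by rewrite coefB coefZ p1S.
clearbody f'' f'; rewrite {1}fE; set rhs := RHS.
rewrite !mulrDr !linearD /= -!scalerAr !linearZ /= !LPP.
have -> : (n == n.+2) = false by rewrite ltn_eqF.
have -> : (n == n.+1) = false by rewrite ltn_eqF.
by rewrite !mulr0 !add0r (orthogonal_lead sf'') f''n f'n.
Qed.

Lemma gamma_H n : H n * g n.+1 = H n.+1.
Proof. by rewrite mulrC /g /= divfK. Qed.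

Lemma coefXM_S q n : ('X * q)`_n.+1 = q`_n.
Proof. by rewrite coefXM. Qed.

Lemma coefX2M_S q n : ('X^2 * q)`_n.+1 = ('X * q)`_n.
Proof. by rewrite expr2 -mulrA coefXM_S. Qed.

Lemma size_XP n : (size ('X * P n)%R <= n.+2)%N.
Proof. by rewrite mulrC size_mulX -?size_poly_eq0 size_P. Qed.

Lemma orthogonal_XP n : L (P n * ('X * P n.+1)) = H n.+1.
Proof.
rewrite mulrCA mulrA mulrC orthogonal_lead ?size_XP //.
by rewrite coefXM_S coef_P_diag mulr1.
Qed.

(** The pairing of [P n] with ['X * P n.+1] is [H n.+1] by moving ['X] to the other factor, and is
    also given by [orthogonal_top3]. This turns later identities involving [g] into identities in
    [p] and [p2]. *)
Lemma gammaE n : g n = p2 n - p2 n.+1 - b n * p n.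
Proof.
case: n => [|n]; first by rewrite /g /p /p2 /= !coefXnM mulr0 !subr0.
rewrite /g /gamma -orthogonal_XP (orthogonal_top3 (size_XP _)) mulrC mulKf //.
rewrite !coefXM_S coef_P_diag !mul1r p1S -coefX2M_S -/(p2 n.+1).
by rewrite /b /beta.
Qed.

(** Pairing a nonzero [q] with the [P m] of the same degree would give [H m] times the leading
    coefficient of [q], which is nonzero. *)
Lemma orthogonal_eq0 n q : (size q <= n)%N ->
  (forall m, (m < n)%N -> L (P m * q) = 0) -> q = 0.
Proof.
move=> sq Lq; apply/eqP/negPn/negP => q0.
have s0 : (0 < size q)%N by rewrite size_poly_gt0.
have := Lq (size q).-1; rewrite prednK // => /(_ sq)/eqP.
rewrite orthogonal_lead ?prednK // mulf_eq0 (negPf (H_neq0 _)) /=.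
by rewrite -[_`__]/(lead_coef q) lead_coef_eq0 (negPf q0).
Qed.

Let prevP n : {poly K} := if n is m.+1 then P m else 0.

(** The difference of the two sides has size at most [n], by comparing coefficients, and is
    orthogonal to every [P m] with [m < n]. *)
Lemma three_term n : 'X * P n =
  P n.+1 + b n *: P n + g n *: prevP n.
Proof.
apply/eqP; rewrite -subr_eq0; apply/eqP.
set q := _ - _.
have prev0 j : (n <= j)%N -> (prevP n)`_j = 0.
  by rewrite /prevP; case: (n) => [|m] nj; rewrite ?coef0 ?coef_P_gt.
apply: (@orthogonal_eq0 n).
  apply/leq_sizeP => j nj; rewrite /q coefB !coefD !coefZ prev0 //.
  move: nj; rewrite leq_eqVlt => /predU1P[<-|].
    by rewrite -p1E p1S coef_P_diag /b /beta -/p; ring.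
  case: j => // j; rewrite coefXM_S ltnS leq_eqVlt => /predU1P[<-|nj].
    by rewrite !coef_P_diag coef_P_gt //; ring.
  by rewrite !coef_P_gt // 1?ltnW //; ring.
case: n @q {prev0} => [|n] q // m mn; rewrite /q /prevP mulrBr raddfB /=.
rewrite !mulrDr -!scalerAr !raddfD /= !functionalZ !LPP.
have -> : (m == n.+2) = false by rewrite ltn_eqF // ltnW.
have -> : (m == n.+1) = false by rewrite ltn_eqF.
rewrite mulr0 oppr0 !add0r -/(gamma H n.+1) -/g.
move: mn; rewrite ltnS leq_eqVlt => /predU1P[->|mn].
  by rewrite eqxx orthogonal_XP mulrC gamma_H subrr.
rewrite ltn_eqF // mulr0 subr0 mulrCA mulrA mulrC orthogonal_small //.
exact: leq_trans (size_XP _) _.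
Qed.

(** * The Jacobi matrix as multiplication by ['X] *)

Lemma jacobiP n : 'X * P n = \sum_(m < n.+2) jacobi P H n m *: P m.
Proof.
rewrite three_term !big_ord_recr /= /jacobi !eqxx [n == n.+1]ltn_eqF // scale1r.
rewrite [LHS]addrC addrCA [LHS]addrC; congr (_ + _ + _); rewrite /prevP.
case: n => [|n]; first by rewrite big_ord0 scaler0.
rewrite big_ord_recr /= eqxx [n == n.+2]ltn_eqF ?[n == n.+1]ltn_eqF //.
rewrite big1 ?add0r // => i _; have ni := ltn_ord i.
rewrite [_ == n.+2]ltn_eqF ?[_ == n.+1]ltn_eqF; last 2 first.
- exact: ltnW.
- by do 2 apply: ltnW.
by rewrite gtn_eqF // scale0r.
Qed.

(** Both sides are the value of [L] at ['X * P k * P m]; this is the symmetry of multiplication by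
    ['X]. *)
Lemma jacobi_sym k m : H k * jacobi P H m k = H m * jacobi P H k m.
Proof.
rewrite /jacobi; case: (ltngtP k m) => [km|mk|->]; last by [].
- rewrite [k == m.+1]ltn_eqF 1?ltnW // ?eqxx.
  case: eqP => [->|_]; first by rewrite -/g gamma_H mulr1.
  by rewrite !mulr0.
- rewrite [m == k.+1]ltn_eqF 1?ltnW // ?eqxx.
  case: eqP => [->|_]; first by rewrite -/g gamma_H mulr1.
  by rewrite !mulr0.
Qed.

Lemma jacobi_eq0 k m : (k.+1 < m)%N -> jacobi P H k m = 0.
Proof.
move=> km; have km' := ltnW km.
by rewrite /jacobi [m == k.+1]gtn_eqF // [m == k]gtn_eqF // ltn_eqF // ltnW.
Qed.

(** By [jacobi_sym], each factor of the transposed Jacobi matrix, weighted by [H], acts as a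
    multiplication of [P k] by ['X]. *)
Lemma exp_jacobi_functional l k j :
  H k * smx_exp (smx_tr (jacobi P H)) l k j = L ('X^l * P j * P k).
Proof.
elim: l k => [|l IHl] k.
  rewrite /= mul1r LPP /smx1 /smx_diag eq_sym.
  by case: eqP => [->|_]; rewrite ?mulr1 ?mulr0.
(* Beyond [k.+1] the row of the transpose vanishes: [jacobi_sym] carries the zeros over because [H]
   has none. *)
rewrite /= (@smx_mulE _ k.+2); last first.
  move=> m km; have := jacobi_sym k m; rewrite (jacobi_eq0 k m) // mulr0 => /eqP.
  by rewrite mulf_eq0 (negPf (H_neq0 _)) /smx_tr => /eqP->; rewrite mul0r.
have -> : 'X^(l.+1) * P j * P k = 'X^l * P j * ('X * P k) by rewrite exprSr; ring.
rewrite jacobiP [in RHS]mulr_sumr raddf_sum mulr_sumr /=.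
apply: eq_bigr => m _; rewrite mulrA /smx_tr jacobi_sym mulrAC IHl -scalerAr.
by rewrite functionalZ mulrC.
Qed.

Lemma horner_jacobi_functional th k j :
  H k * smx_horner th (smx_tr (jacobi P H)) k j = L (th * P j * P k).
Proof.
rewrite -[in RHS](coefK th) poly_def !mulr_suml raddf_sum mulr_sumr /=.
apply: eq_bigr => l _; rewrite -!scalerAl functionalZ -exp_jacobi_functional.
by rewrite mulrCA.
Qed.

(** When [PiV] inverts the dressed Pascal matrix, the inner sum is [P i] shifted by [-1]. *)
Lemma laguerre_freud_functional PiV th i j :
  (forall k, (i < k)%N -> PiV i k = 0) ->
  laguerre_freud P H PiV th i j =
  L (th * P j * \sum_(k < i.+1) PiV i k *: P k).
Proof.
move=> PiV0; have diagE k : smx_mul PiV (smx_diag H) i k = PiV i k * H k.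
  rewrite (@smx_mulE _ k.+1); last first.
    by move=> m km; rewrite /smx_diag gtn_eqF ?mulr0.
  rewrite big_ord_recr /= big1 ?add0r /smx_diag ?eqxx // => m _.
  by rewrite ltn_eqF ?mulr0.
rewrite /laguerre_freud (@smx_mulE _ i.+1); last first.
  by move=> k ik; rewrite diagE PiV0 // !mul0r.
rewrite mulr_sumr raddf_sum /=; apply: eq_bigr => k _.
by rewrite diagE -mulrA horner_jacobi_functional -scalerAr functionalZ.
Qed.

(** * Entries of the structure matrix, through [sigma] and through [theta] *)

Lemma coefs_shift_P (c : K) n :
  [/\ size (P n \Po ('X + c%:P)) = n.+1,
      (P n \Po ('X + c%:P))`_n = 1,
      ('X * (P n \Po ('X + c%:P)))`_n = p n + n%:R * c
    & ('X^2 * (P n \Po ('X + c%:P)))`_n =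
      p2 n + (n%:R - 1) * c * p n + n%:R * (n%:R - 1) / 2 * c ^+ 2].
Proof.
have sP : (size (P n) <= n.+1)%N by rewrite size_P.
have [e0 e1 e2] := coefXn_shift _ c n _ sP; split.
- by rewrite size_shift size_P.
- by rewrite e0 coef_P_diag.
- by rewrite e1 coef_P_diag mulr1 p1E.
- apply: (mulfI (_ : 2 != 0 :> K)); first by rewrite pnatr_eq0.
  by rewrite e2 coef_P_diag -p1E -/(p2 n); field.
Qed.

Variables a1 b1 b2 eta : K.

Lemma coef_sigmaM q k :
  (sigma a1 eta * q)`_k = eta * (('X * q)`_k + a1 * q`_k).
Proof. by rewrite /sigma -scalerAl coefZ mulrDl coefD coefCM. Qed.

Lemma coef_thetaM q k : (theta b1 b2 * q)`_k =
  ('X * ('X^2 * q))`_k + (b1 + b2) * ('X^2 * q)`_k + b1 * b2 * ('X * q)`_k.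
Proof.
have -> : theta b1 b2 * q =
    'X * ('X^2 * q) + (b1 + b2)%:P * ('X^2 * q) + (b1 * b2)%:P * ('X * q).
  by rewrite /theta polyCD polyCM; ring.
by rewrite !coefD !coefCM.
Qed.

Lemma size_sigmaM q n : (size q <= n)%N -> (size (sigma a1 eta * q)%R <= n.+1)%N.
Proof.
move=> qn; apply/leq_sizeP => -[|j] // nj.
rewrite coef_sigmaM coefXM_S !nth_default ?mulr0 ?addr0 ?mulr0 //.
all: by do ?[exact: leq_trans qn nj | apply: leqW].
Qed.

Lemma size_thetaM q n : (size q <= n)%N -> (size (theta b1 b2 * q)%R <= n.+3)%N.
Proof.
move=> qn; apply/leq_sizeP => -[|[|[|j]]] // nj.
rewrite coef_thetaM !(coefXM_S, coefX2M_S) !nth_default ?mulr0 ?addr0 //.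
all: by do ?[exact: leq_trans qn nj | apply: leqW].
Qed.

Hypothesis pearsonL :
  forall q, L (theta b1 b2 * (q \Po ('X - 1%:P))) = L (sigma a1 eta * q).

Local Notation Psi i j := (L (theta b1 b2 * P j * (P i \Po ('X - 1%:P)))).

(** This is the Pearson relation at the product of [P i] with [P j] shifted by [1]: the backward
    shift turns it into [P i] shifted by [-1] times [P j]. *)
Lemma Psi_sigma i j : Psi i j = L (P i * (sigma a1 eta * (P j \Po ('X + 1%:P)))).
Proof. by rewrite mulrCA -pearsonL comp_polyM shiftK; congr (L _); ring. Qed.

Lemma Psi_theta i j : Psi i j = L (P j * (theta b1 b2 * (P i \Po ('X + (-1)%:P)))).
Proof. by rewrite polyCN; congr (L _); ring. Qed.

Lemma Psi_pentadiagonal i j : (j.+1 < i)%N || (i + 3 < j)%N -> Psi i j = 0.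
Proof.
case/orP => ij.
  rewrite Psi_sigma orthogonal_small //; apply: leq_trans ij.
  by apply: size_sigmaM; rewrite size_shift size_P.
rewrite Psi_theta orthogonal_small //; rewrite addn3 in ij; apply: leq_trans ij.
by apply: size_thetaM; rewrite size_shift size_P.
Qed.

Lemma Psi_sub n : Psi n.+1 n = eta * H n.+1.
Proof.
have [sq q0 _ _] := coefs_shift_P 1 n; rewrite Psi_sigma orthogonal_lead; last first.
  by apply: size_sigmaM; rewrite sq.
by rewrite coef_sigmaM coefXM_S q0 (nth_default _ (_ : size _ <= n.+1)%N) ?sq //; ring.
Qed.

Lemma Psi_diag n : Psi n n = eta * H n * (n%:R + b n + a1).
Proof.
have [sq q0 q1 _] := coefs_shift_P 1 n; rewrite Psi_sigma orthogonal_top3; last first.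
  by apply/leqW/size_sigmaM; rewrite sq.
rewrite !coef_sigmaM !coefXM_S q0 q1 !(@nth_default _ _ (P n \Po _)) ?sq //.
by rewrite /b /beta -/p; ring.
Qed.

(** The product with [sigma] has degree [n.+2], so three coefficients enter. Writing [H n.+1] as
    [H n * g n.+1] and expanding [g] by [gammaE] leaves an identity in [p] and [p2]. *)
Lemma Psi_super n : Psi n n.+1 =
  eta * (H n.+1 + H n * (n%:R * n.+1%:R / 2 - n%:R * b n - p n
                         + n.+1%:R * (b n + a1))).
Proof.
have [sq q0 q1 q2] := coefs_shift_P 1 n.+1.
rewrite Psi_sigma orthogonal_top3; last by apply/size_sigmaM; rewrite sq.
rewrite coefXM_S in q1; rewrite coefX2M_S in q2.
rewrite -gamma_H gammaE !coef_sigmaM !coefXM_S q0 q1 q2.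
rewrite !(@nth_default _ _ (P n.+1 \Po _)) ?sq // /b /beta -/p -nat1r.
by field.
Qed.

Lemma Psi_super2 n : Psi n n.+2 =
  H n.+2 * (b n + b n.+1 + b n.+2 + b1 + b2 - n%:R).
Proof.
have n3 : (n < n.+3)%N by exact: leqW.
have [sq q0 q1 _] := coefs_shift_P (-1) n.
rewrite Psi_theta orthogonal_top3; last by apply/leqW/size_thetaM; rewrite sq.
rewrite !coef_thetaM !(coefXM_S, coefX2M_S) q0 q1.
rewrite !(@nth_default _ _ (P n \Po _)) ?sq //.
by rewrite /b /beta -/p; ring.
Qed.

Lemma Psi_super3 n : Psi n n.+3 = H n.+3.
Proof.
have [sq q0 _ _] := coefs_shift_P (-1) n.
rewrite Psi_theta orthogonal_lead; last by apply/size_thetaM; rewrite sq.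
rewrite !coef_thetaM !(coefXM_S, coefX2M_S) q0.
by rewrite !(@nth_default _ _ (P n \Po _)) ?sq //; ring.
Qed.

Lemma Psi_super_theta n : Psi n n.+1 =
  H n.+1 * (g n + g n.+1 + g n.+2 + (b n.+1 + b1) * (b n.+1 + b2)
            + b n * (b n.+1 + b n + b1 + b2)
            - n%:R * (2 * b n + b n.+1 + b1 + b2 - n%:R)
            - (n%:R * n.+1%:R / 2 - n%:R * b n - p n)).
Proof.
have [sq q0 q1 q2] := coefs_shift_P (-1) n.
rewrite Psi_theta orthogonal_top3; last by apply/size_thetaM; rewrite sq.
rewrite !coef_thetaM !(coefXM_S, coefX2M_S) q0 q1 q2.
rewrite !(@nth_default _ _ (P n \Po _)) ?sq // !gammaE /b /beta -/p -nat1r.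
by field.
Qed.

(** The left-hand side enters [Psi_super] with coefficient [eta * H n] and [Psi_super_theta] with
    coefficient [- (H n * g n.+1)], whence the divisor [eta + g n.+1]. *)
Lemma Psi_super_solve n : eta + g n.+1 != 0 ->
  n%:R * n.+1%:R / 2 - n%:R * b n - p n =
  (eta + g n.+1)^-1 *
  (g n.+1 * (g n + g n.+1 + g n.+2 + (b n.+1 + b1) * (b n.+1 + b2)
             + b n * (b n.+1 + b n + b1 + b2)
             - n%:R * (2 * b n + b n.+1 + b1 + b2 - n%:R) - eta)
   - eta * n.+1%:R * (b n + a1)).
Proof.
move=> eg0; have := Psi_super n; rewrite Psi_super_theta -gamma_H => Psi2.
apply: (mulfI eg0); rewrite mulVKf //; apply: (mulfI (H_neq0 n)).
apply/eqP; rewrite -subr_eq0; move/eqP: Psi2; rewrite eq_sym -subr_eq0.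
by congr (_ == 0); ring.
Qed.

(** For positive [n], pairing the expansion of the shifted [P n.+1] with [P n.-1] isolates the
    required entry of [Pi]. *)
Lemma pi2E Pi n : dressed_pascal P Pi ->
  pi2 Pi (n%:Z - 1) = n%:R * n.+1%:R / 2 - n%:R * b n - p n.
Proof.
(* At [n = 0] both sides vanish, by the conventions for [pi2] at [-1] and for [p 0]. *)
move=> [_ PiP]; case: n => [|n]; first by rewrite /= !mul0r !subr0.
have -> : n.+1%:Z - 1 = n%:Z by rewrite -[n.+1]addn1 PoszD addrK.
apply: (mulfI (H_neq0 n)).
have [sq q0 q1 q2] := coefs_shift_P 1 n.+2.
have <- : L (P n * (P n.+2 \Po ('X + 1%:P))) = H n * Pi n.+2 n.
  rewrite polyC1 PiP mulr_sumr raddf_sum /=.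
  rewrite (bigD1 (inord n)) //= inordK ?ltnS ?leqW //.
  rewrite -scalerAr functionalZ LPP eqxx mulrC big1 ?addr0 // => m mn.
  rewrite -scalerAr functionalZ LPP; case: eqP => [nm|_]; last by rewrite mulr0.
  by case/eqP: mn; apply/val_inj; rewrite /= inordK ?ltnS ?leqW.
rewrite orthogonal_top3 ?sq //; rewrite coefXM_S in q1.
rewrite coefX2M_S coefXM_S in q2; rewrite q0 q1 q2 /b /beta -/p -!nat1r.
by field.
Qed.

End OrthogonalFunctional.

(** * The inverse of the dressed Pascal matrix *)

(** Strong induction on the row: as [A] has unit diagonal, row [i] of the product expresses [B i j]
    through entries of [B] in earlier rows. *)
Lemma inverse_lower (K : fieldType) (A B : smx K) :
  lower_unitriangular A -> smx_inverse A B ->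
  forall i j, (i < j)%N -> B i j = 0.
Proof.
move=> [A0 A1] [AB _] i j; elim/ltn_ind: i => i IHi ij.
have := AB i j; rewrite (@smx_mulE _ i.+1); last by move=> k ik; rewrite A0 ?mul0r.
rewrite big_ord_recr /= A1 mul1r /smx1 /smx_diag ltn_eqF // big1 ?add0r // => k _.
by rewrite IHi ?mulr0 // (ltn_trans _ ij).
Qed.

(** After shifting both sides forward, expanding each [P k] with [Pi] produces the product of [PiV]
    and [Pi], which is the identity. *)
Lemma dressed_pascal_inverse (K : numFieldType) (P : nat -> {poly K})
    (Pi PiV : smx K) :
  dressed_pascal P Pi -> smx_inverse Pi PiV ->
  forall i, P i \Po ('X - 1%:P) = \sum_(k < i.+1) PiV i k *: P k.
Proof.
move=> [Pi_lower PiP] PiVP i; have [Pi0 _] := Pi_lower.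
have PiV0 := @inverse_lower _ _ _ Pi_lower PiVP; have [_ VPi] := PiVP.
rewrite -[RHS](@shiftK _ _ 1); congr (_ \Po _).
(* The zeros of [Pi] above the diagonal give all expansions the same range, so that the two sums can
   be exchanged. *)
have PiE (k : 'I_i.+1) : P k \Po ('X + 1%:P) = \sum_(m < i.+1) Pi k m *: P m.
  rewrite polyC1 PiP (big_ord_widen i.+1 (fun m => Pi k m *: P m)) // big_mkcond /=.
  apply: eq_bigr => m _; case: ltnP => // km.
  by rewrite Pi0 ?scale0r.
rewrite raddf_sum /=.
under eq_bigr => k _ do rewrite linearZ /= PiE scaler_sumr.
rewrite exchange_big /= big_ord_recr /=.
have VPiE m : \sum_(k < i.+1) PiV i k *: (Pi k m *: P m) = smx1 K i m *: P m.
  under eq_bigr do rewrite scalerA.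
  rewrite -scaler_suml -VPi (@smx_mulE _ i.+1) // => k ik.
  by rewrite PiV0 // mul0r.
rewrite VPiE big1 => [|m _]; first by rewrite add0r /smx1 /smx_diag eqxx scale1r.
by rewrite VPiE /smx1 /smx_diag gtn_eqF // scale0r.
Qed.

(* Subleading coefficients and the pentadiagonal structure matrix *)
Local Close Scope classical_set_scope.

Theorem theorem3 (R : realType) (a1 b1 b2 eta : R[i])
    (eta_neq0 : eta != 0)
    (b1_ok : not_negative_integer b1) (b2_ok : not_negative_integer b2)
    (hankel_neq0 : forall k : nat, \det (hankel (weight a1 b1 b2 eta) k) != 0)
    (P : nat -> {poly R[i]}) (H : nat -> R[i])
    (PH : monic_orthogonal (weight a1 b1 b2 eta) P H)
    (Pi PiV : smx R[i])
    (Pi_pascal : dressed_pascal P Pi) (PiV_inv : smx_inverse Pi PiV) :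
  let p := p1 P in
  let b := beta P in
  let g := gamma H in
  let Psi := laguerre_freud P H PiV (theta b1 b2) in
  let E := fun n : nat =>
    (g n.+1 * (g n + g n.+1 + g n.+2
                + (b n.+1 + b1) * (b n.+1 + b2)
                + b n * (b n.+1 + b n + b1 + b2)
                - n%:R * (2 * b n + b n.+1 + b1 + b2 - n%:R)
                - eta)
     - eta * n.+1%:R * (b n + a1)) in
  (forall n : nat, eta + g n.+1 != 0 ->
     p n = (n * n.+1)%:R / 2 - n%:R * b n - (eta + g n.+1)^-1 * E n
     /\ pi2 Pi (n%:Z - 1) = (eta + g n.+1)^-1 * E n)
  /\ (forall i j : nat, (j.+1 < i)%N || (i + 3 < j)%N -> Psi i j = 0)
  /\ (forall n : nat,
        [/\ Psi n.+1 n = eta * H n.+1,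
            Psi n n = eta * H n * (n%:R + b n + a1),
            Psi n n.+1 =
              eta * (H n.+1
                     + H n * (pi2 Pi (n%:Z - 1) + n.+1%:R * (b n + a1))),
            Psi n n.+2 =
              H n.+2 * (b n + b n.+1 + b n.+2 + b1 + b2 - n%:R)
          & Psi n n.+3 = H n.+3]).
Proof.
move=> p b g Psi E.
have [Pm sP H0 PP] := PH.
have [L LE] := weighted_sum_functional _ _ _ _ PH.
have LPP n m : L (P n * P m) = if n == m then H n else 0.
  have := LE (P n * P m); under eq_fun do rewrite hornerM.
  by move/(cvg_unique _); apply => //; exact: PP.
have pL := pearson_functional _ _ _ _ _ _ b1_ok b2_ok LE.
have PsiL i j : Psi i j = L (theta b1 b2 * P j * (P i \Po ('X - 1%:P))).
  rewrite (dressed_pascal_inverse _ _ _ _ Pi_pascal PiV_inv).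
  apply: laguerre_freud_functional => // k.
  by apply: inverse_lower PiV_inv _ _; case: Pi_pascal.
have pi2P n := pi2E _ _ _ L Pm sP H0 LPP _ n Pi_pascal.
have PsiS n := Psi_super _ _ _ L Pm sP H0 LPP _ _ _ _ pL n.
split; last split; last first.
- move=> n; split; rewrite PsiL.
  + exact: (Psi_sub _ _ _ _ Pm sP LPP _ _ _ _ pL).
  + exact: (Psi_diag _ _ _ _ Pm sP LPP _ _ _ _ pL).
  + by rewrite PsiS pi2P.
  + exact: (Psi_super2 _ _ _ _ Pm sP LPP).
  + exact: (Psi_super3 _ _ _ _ Pm sP LPP).
- move=> i j ij; rewrite PsiL.
  exact: (Psi_pentadiagonal _ _ _ _ Pm sP LPP _ _ _ _ pL).
move=> n eg0.
have pi2EE : pi2 Pi (n%:Z - 1) = (eta + g n.+1)^-1 * E n.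
  rewrite pi2P; exact: (Psi_super_solve _ _ _ _ Pm sP H0 LPP _ _ _ _ pL n).
by split=> //; rewrite -pi2EE pi2P natrM subKr.
Qed.
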